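(* Let $\mathbf{F}$ be a Fraïssé structure in $L$ and let $\mathbf{F}^{*}$ be a Fraïssé precompact relational expansion of $\mathbf{F}$ in $L^{*}$. Assume that $\mathrm{Age}(\mathbf{F}^{*})$ consists of rigid elements and that the pair $(\mathrm{Age}(\mathbf{F}),\mathrm{Age}(\mathbf{F}^{*}))$ has the relative Ramsey property for structures. Then $\mathrm{Age}(\mathbf{F}^{*})$ admits a Fraïssé subclass with the Ramsey property and the expansion property relative to $\mathrm{Age}(\mathbf{F})$.
   Context: $\mathbb{N}=\{0,1,2,\ldots\}$ and $[k]=\{0,\ldots,k-1\}$. $L$ is a countable first-order signature and $L^{*}=L\cup\{R_i : i\in I^{*}\}$, where $I^{*}$ is countable and each $R_i$ is a relation symbol not in $L$. A Fraïssé structure is a countable (infinite), locally finite (finitely generated substructures are finite), ultrahomogeneous structure (every isomorphism between finite substructures extends to an automorphism). $\mathrm{Age}(\mathbf{F})$ is the class of finite structures that embed in $\mathbf{F}$. A Fraïssé class is a countable (up to isomorphism) class of finite structures, of arbitrarily large sizes, satisfying the hereditary, joint embedding and amalgamation properties; a Fraïssé subclass of $\mathrm{Age}(\mathbf{F}^{*})$ is a Fraïssé class in $L^{*}$ contained in $\mathrm{Age}(\mathbf{F}^{*})$. An expansion $\mathbf{F}^{*}$ of $\mathbf{F}$ in $L^{*}$ is an $L^{*}$-structure whose $L$-reduct is $\mathbf{F}$; ''Fraïssé expansion'' means $\mathbf{F}^{*}$ is itself a Fraïssé structure in $L^{*}$. It is precompact if every element of $\mathrm{Age}(\mathbf{F})$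 has only finitely many expansions in $\mathrm{Age}(\mathbf{F}^{*})$. Both have universe $\mathbb{N}$. A structure is rigid if its only automorphism is the identity. A class $\mathcal{K}^{*}$ of $L^{*}$-structures is an expansion in $L^{*}$ of a class $\mathcal{K}$ of $L$-structures if every element of $\mathcal{K}^{*}$ is an expansion of an element of $\mathcal{K}$ and every element of $\mathcal{K}$ has an expansion in $\mathcal{K}^{*}$. For $\mathbf{B}^{*}\in\mathcal{K}^{*}$, $\mathbf{B}$ denotes its $L$-reduct. $\binom{\mathbf{B}}{\mathbf{A}}$ is the set of substructures of $\mathbf{B}$ isomorphic to $\mathbf{A}$, and $\binom{\mathbf{B}}{\mathbf{A}}_{\mathrm{Emb}}$ is the set of embeddings of $\mathbf{A}$ into $\mathbf{B}$. For $\widetilde{\mathbf{A}}_0,\widetilde{\mathbf{A}}_1\in\binom{\mathbf{B}}{\mathbf{A}}$ with universes $\tilde A_0,\tilde A_1$, write $\widetilde{\mathbf{A}}_0\cong_{\mathbf{B}^{*}}\widetilde{\mathbf{A}}_1$ if the substructures $\mathbf{B}^{*}\upharpoonright\tilde A_0$ and $\mathbf{B}^{*}\upharpoonright\tilde A_1$ of $\mathbf{B}^{*}$ are isomorphic. For $\mathcal{K}$ a class of finite $L$-structures and $\mathcal{K}^{*}$ an expansion of $\mathcal{K}$ in $L^{*}$, the pair $(\mathcal{K},\mathcal{K}^{*})$ has the relative Ramsey property for structures if for every $k\in\mathbb{N}$, $\mathbf{A}\in\mathcal{K}$, $\mathbf{B}^{*}\in\mathcal{K}^{*}$, there exists $\mathbf{C}\in\mathcal{K}$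 such that for every coloring $c:\binom{\mathbf{C}}{\mathbf{A}}\to[k]$ there exists $b\in\binom{\mathbf{C}}{\mathbf{B}}_{\mathrm{Emb}}$ such that for all $\widetilde{\mathbf{A}}_0,\widetilde{\mathbf{A}}_1\in\binom{\mathbf{B}}{\mathbf{A}}$, $\widetilde{\mathbf{A}}_0\cong_{\mathbf{B}^{*}}\widetilde{\mathbf{A}}_1$ implies $c(b(\widetilde{\mathbf{A}}_0))=c(b(\widetilde{\mathbf{A}}_1))$. A class $\mathcal{K}^{*}$ has the expansion property relative to $\mathcal{K}$ if it is an expansion of $\mathcal{K}$ and for every $\mathbf{A}\in\mathcal{K}$ there exists $\mathbf{B}\in\mathcal{K}$ such that for all $\mathbf{A}^{*},\mathbf{B}^{*}\in\mathcal{K}^{*}$ with $L$-reducts $\mathbf{A}$ and $\mathbf{B}$ respectively, $\mathbf{A}^{*}$ embeds in $\mathbf{B}^{*}$. A class $\mathcal{C}$ of finite structures has the Ramsey property if for every $k\in\mathbb{N}$ and $\mathbf{A},\mathbf{B}\in\mathcal{C}$ there exists $\mathbf{C}\in\mathcal{C}$ such that for every $c:\binom{\mathbf{C}}{\mathbf{A}}\to[k]$ there is $\widetilde{\mathbf{B}}\in\binom{\mathbf{C}}{\mathbf{B}}$ such that $c$ takes at most one value on $\binom{\widetilde{\mathbf{B}}}{\mathbf{A}}$. *)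

(* Defs.v *)
From mathcomp Require Import all_boot.
From mathcomp Require Import boolp classical_sets functions cardinality.

Set Implicit Arguments.
Unset Strict Implicit.
Unset Printing Implicit Defensive.

Local Open Scope classical_set_scope.

Record signature := Signature {
  fsym : Type;
  rsym : Type;
  farity : fsym -> nat;
  rarity : rsym -> nat }.

Definition countable_signature (L : signature) : Prop :=
  countable [set: fsym L] /\ countable [set: rsym L].

(* The signature obtained from L by adjoining relation symbols R_i, i : I; the
   disjoint sum makes them distinct from the symbols of L. *)
Definition add_relations (L : signature) (I : Type) (ar : I -> nat) :
    signature :=
  {| fsym := fsym L;
     rsym := (rsym L + I)%type;
     farity := @farity L;
     rarity := fun r => match r with inl r0 => rarity r0 | inr i => ar i end |}.

(* T may be empty, and symbols may have arity 0. *)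
Record structure (L : signature) (T : Type) := Structure {
  fun_interp : forall f : fsym L, ('I_(farity f) -> T) -> T;
  rel_interp : forall r : rsym L, set ('I_(rarity r) -> T) }.

Definition reduct (L : signature) (I : Type) (ar : I -> nat) (T : Type)
    (As : structure (add_relations L ar) T) : structure L T :=
  {| fun_interp := fun f : fsym L =>
       @fun_interp (add_relations L ar) T As f;
     rel_interp := fun r : rsym L =>
       @rel_interp (add_relations L ar) T As (inl r) |}.

Record embedding (L : signature) (T U : Type)
    (A : structure L T) (B : structure L U) := Embedding {
  emb_map :> T -> U;
  emb_inj : injective emb_map;
  emb_fun : forall (f : fsym L) (x : 'I_(farity f) -> T),
    emb_map (fun_interp A x) = fun_interp B (emb_map \o x);
  emb_rel : forall (r : rsym L) (x : 'I_(rarity r) -> T),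
    rel_interp A x <-> rel_interp B (emb_map \o x) }.

Definition embeds (L : signature) (T U : Type)
    (A : structure L T) (B : structure L U) : Prop :=
  inhabited (embedding A B).

Definition isomorphic (L : signature) (T U : Type)
    (A : structure L T) (B : structure L U) : Prop :=
  exists h : embedding A B, bijective h.

Definition rigid (L : signature) (T : Type) (A : structure L T) : Prop :=
  forall g : embedding A A, bijective g -> forall x : T, g x = x.

Definition fun_closed (L : signature) (T : Type) (A : structure L T) :
    set (set T) :=
  [set S | forall (f : fsym L) (x : 'I_(farity f) -> T),
     (forall i, S (x i)) -> S (fun_interp A x)].

Record substructure (L : signature) (T : Type) (A : structure L T) :=
  Substructure {
    universe : set T;
    universe_closed : fun_closed A universe }.

Lemma induced_closed (L : signature) (T : Type) (A : structure L T)
    (S : substructure A) (f : fsym L) (x : 'I_(farity f) -> universe S) :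
  fun_interp A (fun i => val (x i)) \in universe S.
Proof. by apply/mem_set/universe_closed => i; exact: set_valP. Qed.

Definition induced (L : signature) (T : Type) (A : structure L T)
    (S : substructure A) : structure L (universe S) :=
  {| fun_interp := fun (f : fsym L) (x : 'I_(farity f) -> universe S) =>
       exist _ (fun_interp A (fun i => val (x i))) (induced_closed x);
     rel_interp := fun (r : rsym L) (x : 'I_(rarity r) -> universe S) =>
       rel_interp A (fun i => val (x i)) |}.

Lemma image_closed (L : signature) (T U : Type) (A : structure L T)
    (B : structure L U) (h : embedding A B) (S : substructure A) :
  fun_closed B (h @` universe S).
Proof.
move=> f y Sy; pose x i := projT1 (cid2 (Sy i)).
have xS i : universe S (x i) by rewrite /x; case: cid2.
exists (fun_interp A x); first exact: universe_closed.
rewrite emb_fun; congr (fun_interp B _); apply/funext => i /=.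
by rewrite /x; case: cid2.
Qed.

Definition image_sub (L : signature) (T U : Type) (A : structure L T)
    (B : structure L U) (h : embedding A B) (S : substructure A) :
    substructure B :=
  {| universe := h @` universe S; universe_closed := @image_closed L T U A B h S |}.

(* The substructure of an expansion with the same universe as S; it is one
   because expansions add no function symbols. *)
Definition expand_sub (L : signature) (I : Type) (ar : I -> nat) (T : Type)
    (As : structure (add_relations L ar) T) (S : substructure (reduct As)) :
    substructure As :=
  @Substructure (add_relations L ar) T As (universe S)
    (@universe_closed L T (reduct As) S).

Definition copies (L : signature) (T U : Type)
    (A : structure L T) (B : structure L U) : set (substructure B) :=
  [set S | isomorphic A (induced S)].
Arguments copies {L T U} A B _.

Definition locally_finite (L : signature) (T : Type) (F : structure L T) :
    Prop :=
  forall X : set T, finite_set X -> finite_set (smallest (fun_closed F) X).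

Definition ultrahomogeneous (L : signature) (T : Type) (F : structure L T) :
    Prop :=
  forall S0 S1 : substructure F,
    finite_set (universe S0) -> finite_set (universe S1) ->
    forall h : embedding (induced S0) (induced S1), bijective h ->
    exists g : embedding F F,
      bijective g /\ forall x : universe S0, g (val x) = val (h x).

Definition fraisse_structure (L : signature) (T : Type) (F : structure L T) :
    Prop :=
  [/\ countable [set: T], infinite_set [set: T],
      locally_finite F & ultrahomogeneous F].

Definition structure_class (L : signature) : Type :=
  forall T : Type, structure L T -> Prop.

Definition age (L : signature) (V : Type) (F : structure L V) :
    structure_class L :=
  fun (T : Type) (A : structure L T) => finite_set [set: T] /\ embeds A F.

Definition countable_up_to_iso (L : signature) (K : structure_class L) : Prop :=
  exists (V : nat -> Type) (M : forall n : nat, structure L (V n)),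
    forall (T : Type) (A : structure L T), K T A ->
      exists n : nat, isomorphic A (M n).

Definition hereditary (L : signature) (K : structure_class L) : Prop :=
  forall (T U : Type) (A : structure L T) (B : structure L U),
    K U B -> embeds A B -> K T A.

Definition joint_embedding (L : signature) (K : structure_class L) : Prop :=
  forall (T U : Type) (A : structure L T) (B : structure L U),
    K T A -> K U B ->
    exists (V : Type) (C : structure L V), [/\ K V C, embeds A C & embeds B C].

Definition amalgamation (L : signature) (K : structure_class L) : Prop :=
  forall (T U V : Type)
    (A : structure L T) (B : structure L U) (C : structure L V),
    K T A -> K U B -> K V C ->
    forall (f : embedding A B) (g : embedding A C),
    exists (W : Type) (D : structure L W), K W D /\
      exists (r : embedding B D) (s : embedding C D),
        forall x : T, r (f x) = s (g x).

Definition fraisse_class (L : signature) (K : structure_class L) : Prop :=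
  [/\ forall (T : Type) (A : structure L T), K T A -> finite_set [set: T],
      countable_up_to_iso K,
      forall n : nat, exists (T : Type) (A : structure L T),
        K T A /\ (card_le `I_n [set: T])
    & [/\ hereditary K, joint_embedding K & amalgamation K]].

Definition expansion_class (L : signature) (I : Type) (ar : I -> nat)
    (K : structure_class L) (Ks : structure_class (add_relations L ar)) :
    Prop :=
  (forall (T : Type) (As : structure (add_relations L ar) T),
     Ks T As -> K T (reduct As)) /\
  (forall (T : Type) (A : structure L T), K T A ->
     exists As : structure (add_relations L ar) T, Ks T As /\ reduct As = A).

Definition precompact (L : signature) (I : Type) (ar : I -> nat) (V : Type)
    (F : structure L V) (Fs : structure (add_relations L ar) V) : Prop :=
  forall (T : Type) (A : structure L T), age F A ->
    finite_set [set As : structure (add_relations L ar) T |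
                 age Fs As /\ reduct As = A].

(* In the Ramsey properties a coloring of the copies of A in C is a map on all
   substructures of C that sends these copies into `I_k = {0, ..., k - 1}; its
   values elsewhere are irrelevant. *)

Definition relative_ramsey (L : signature) (I : Type) (ar : I -> nat)
    (K : structure_class L) (Ks : structure_class (add_relations L ar)) :
    Prop :=
  forall (k : nat) (T U : Type) (A : structure L T)
    (Bs : structure (add_relations L ar) U),
    K T A -> Ks U Bs ->
    exists (V : Type) (C : structure L V), K V C /\
      forall c : substructure C -> nat, set_fun (copies A C) `I_k c ->
      exists b : embedding (reduct Bs) C,
      forall A0 A1 : substructure (reduct Bs),
        copies A (reduct Bs) A0 -> copies A (reduct Bs) A1 ->
        isomorphic (induced (expand_sub A0)) (induced (expand_sub A1)) ->
        c (image_sub b A0) = c (image_sub b A1).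

Definition expansion_property (L : signature) (I : Type) (ar : I -> nat)
    (K : structure_class L) (Ks : structure_class (add_relations L ar)) :
    Prop :=
  expansion_class K Ks /\
  forall (T : Type) (A : structure L T), K T A ->
  exists (U : Type) (B : structure L U), K U B /\
    forall (As : structure (add_relations L ar) T)
      (Bs : structure (add_relations L ar) U),
      Ks T As -> Ks U Bs -> reduct As = A -> reduct Bs = B -> embeds As Bs.

Definition ramsey_property (L : signature) (K : structure_class L) : Prop :=
  forall (k : nat) (T U : Type) (A : structure L T) (B : structure L U),
    K T A -> K U B ->
    exists (V : Type) (C : structure L V), K V C /\
      forall c : substructure C -> nat, set_fun (copies A C) `I_k c ->
      exists2 B0 : substructure C, copies B C B0 &
        forall A0 A1 : substructure C,
          copies A C A0 -> copies A C A1 ->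
          universe A0 `<=` universe B0 -> universe A1 `<=` universe B0 ->
          c A0 = c A1.

(* Main.v *)
Require Import Defs.
From mathcomp Require Import all_boot.
From mathcomp Require Import boolp classical_sets functions cardinality.

Set Implicit Arguments.
Unset Strict Implicit.
Unset Printing Implicit Defensive.

Local Open Scope classical_set_scope.

(** The subclass Ks is a minimal one among the hereditary subclasses of Age(Fs)
    in which every element of Age(F) has an expansion; it corresponds
    to a minimal subflow of the space of expansions of F. It is obtained by
    omitting a maximal family of structures; as each element of Age(F) has
    finitely many expansions, Zorn's lemma applies ([exists_maximal_avoided]).

    Minimality is the expansion property. If As is in Ks, the elements of Ks in
    which As does not embed no longer expand all of Age(F), so some B in Age(F)
    has As in each of its expansions in Ks ([exists_expansion_property]).

    The relative Ramsey property then passes to the Ramsey property of Ks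
    ([ramsey_expansion]). Let D in Age(F) be such that all its expansions in Ks
    contain Bs and all expansions of A in Ks, let Ds be one of them, and let C
    be a relative Ramsey witness for A and Ds. Given an expansion Cs of C in Ks,
    colour the copies of A in C by their type in Cs, refined by the given colour
    on the copies of As. On some copy of D the type of a copy of A in Ds
    determines its type in Cs. Both expansions of D realise all types, and there
    are finitely many of them, so the correspondence of types is one-to-one:
    copies of As in Cs have the same type in Ds, hence the same colour.

    Joint embedding in Ks comes from the expansion property, and amalgamation
    from the Ramsey property and rigidity, as a copy of a rigid structure is the
    range of a single embedding ([amalgamation_ramsey]). *)

(** * Finite sets *)

Lemma finite_set_induction (T : Type) (P : set T -> Prop) :
  P set0 -> (forall x E, P E -> P (x |` E)) -> forall E, finite_set E -> P E.
Proof.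
elim/Pchoice: T => T in P *.
move=> P0 PU E /finite_seqP[s ->] {E}; elim: s => [|x s IHs].
  by have -> : [set` [::]] = set0 :> set T by apply/seteqP; split.
rewrite (_ : [set` x :: s] = x |` [set` s]); first exact: PU.
apply/predeqP => y /=; rewrite inE.
split=> [/orP[/eqP ->|ys]|[->|->]]; [by left|by right|by rewrite eqxx|].
exact: orbT.
Qed.

Lemma surj_ord_inj (n : nat) (f : 'I_n -> 'I_n) :
  (forall i, exists j, f j = i) -> injective f.
Proof.
move=> /choice[g gK].
by apply: bij_inj; apply: (bij_can_bij (injF_bij (can_inj gK)) gK).
Qed.

(** For an equivalence relation this is a system of representatives of the
    classes; transitivity is not needed for its existence. *)
Lemma finite_transversal (T : Type) (R : T -> T -> Prop) (E : set T) :
  (forall x, R x x) -> (forall x y, R x y -> R y x) -> finite_set E ->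
  exists (n : nat) (rep : 'I_n -> T),
    [/\ forall i, E (rep i),
        forall i j, R (rep i) (rep j) -> i = j
      & forall x, E x -> exists i, R x (rep i)].
Proof.
move=> Rxx Rsym; apply: (finite_set_induction (P := fun E =>
  exists (n : nat) (rep : 'I_n -> T),
    [/\ forall i, E (rep i), forall i j, R (rep i) (rep j) -> i = j
      & forall x, E x -> exists i, R x (rep i)])) => {E} [|x E].
  have none : 'I_0 -> False by case.
  by exists 0, (fun i => False_rect T (none i)); split => // i; case: (none i).
case=> n [rep [repE repI repR]].
have [[i xi]|xN] := pselect (exists i, R x (rep i)).
  exists n, rep; split => // [j|y [->|/repR//]]; first by right.
  by exists i.
exists n.+1, (fun i => if unlift ord0 i is Some j then rep j else x).
split=> [i|i j|y [->|/repR[i yi]]].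
- by case: unliftP => [j _|_]; [right; exact: repE|left].
- case: unliftP => [i' ->|->]; case: unliftP => [j' ->|->] //.
  + by move=> /repI ->.
  + by move=> /Rsym ?; case: xN; exists i'.
  + by move=> ?; case: xN; exists j'.
- by exists ord0; rewrite unlift_none.
- by exists (lift ord0 i); rewrite liftK.
Qed.

(** * Embeddings, isomorphisms and copies *)

Definition emb_id (L : signature) (T : Type) (A : structure L T) :
  embedding A A.
Proof. by exists id. Defined.

Definition emb_comp (L : signature) (T U V : Type) (A : structure L T)
  (B : structure L U) (C : structure L V) (g : embedding B C)
  (f : embedding A B) : embedding A C.
Proof.
exists (g \o f) => [|s x|r x].
- exact: inj_comp (@emb_inj _ _ _ _ _ g) (@emb_inj _ _ _ _ _ f).
- by rewrite /= (emb_fun f) (emb_fun g).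
- by rewrite (emb_rel f) (emb_rel g).
Defined.

Lemma embeds_trans (L : signature) (T U V : Type) (A : structure L T)
    (B : structure L U) (C : structure L V) :
  embeds A B -> embeds B C -> embeds A C.
Proof. by move=> [f] [g]; exact: inhabits (emb_comp g f). Qed.

(** An embedding whose range lies in the range of another one factors through
    it. *)
Lemma emb_factor (L : signature) (T U V : Type) (A : structure L T)
    (B : structure L U) (C : structure L V) (f : embedding A C)
    (g : embedding B C) :
  range f `<=` range g -> exists h : embedding A B, forall x, g (h x) = f x.
Proof.
move=> fg.
have /choice[h hE] : forall x, exists y, g y = f x.
  by move=> x; have [|y _ <-] := fg (f x); [exists x|exists y].
have gh n (x : 'I_n -> T) : g \o (h \o x) = f \o x.
  by apply/funext => i; exact: hE.
have hI : injective h.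
  by move=> x y xy; apply: (@emb_inj _ _ _ _ _ f); rewrite -!hE xy.
have hF (s : Defs.fsym L) (x : 'I_(farity s) -> T) :
    h (fun_interp A x) = fun_interp B (h \o x).
  by apply: (@emb_inj _ _ _ _ _ g); rewrite hE !emb_fun gh.
have hR (r : rsym L) (x : 'I_(rarity r) -> T) :
    rel_interp A x <-> rel_interp B (h \o x).
  by rewrite (emb_rel f) (emb_rel g) gh.
by exists (Embedding hI hF hR).
Qed.

Lemma isomorphic_refl (L : signature) (T : Type) (A : structure L T) :
  isomorphic A A.
Proof. by exists (emb_id A); exists id. Qed.

Lemma isomorphic_trans (L : signature) (T U V : Type) (A : structure L T)
    (B : structure L U) (C : structure L V) :
  isomorphic A B -> isomorphic B C -> isomorphic A C.
Proof.
by move=> [f fb] [g gb]; exists (emb_comp g f); exact: bij_comp.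
Qed.

Lemma isomorphic_sym (L : signature) (T U : Type) (A : structure L T)
    (B : structure L U) : isomorphic A B -> isomorphic B A.
Proof.
move=> [f fb]; have [g _ gK] := fb.
have [|h hE] := @emb_factor _ _ _ _ B A B (emb_id B) f.
  by move=> y _; exists (g y).
by exists h; exists f => // x; apply: (@emb_inj _ _ _ _ _ f); rewrite hE.
Qed.

Lemma isomorphic_embeds (L : signature) (T U : Type) (A : structure L T)
    (B : structure L U) : isomorphic A B -> embeds A B.
Proof. by move=> [f _]; exact: inhabits f. Qed.

Definition emb_val (L : signature) (T : Type) (A : structure L T)
  (S : substructure A) : embedding (induced S) A.
Proof. by exists val => //; exact: val_inj. Defined.

Lemma range_emb_val (L : signature) (T : Type) (A : structure L T)
  (S : substructure A) : range (emb_val S) = universe S.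
Proof.
apply/seteqP; split=> [_ [x _ <-]|x Sx]; first exact: set_valP.
by exists (exist _ x (mem_set Sx)).
Qed.

Lemma substructure_ext (L : signature) (T : Type) (A : structure L T)
  (S S' : substructure A) : universe S = universe S' -> S = S'.
Proof.
case: S S' => [S Sc] [S' S'c] /= SS'.
by case: _ / SS' S'c => S'c; congr Substructure; exact: Prop_irrelevance.
Qed.

Lemma range_closed (L : signature) (T U : Type) (A : structure L T)
  (B : structure L U) (h : embedding A B) : fun_closed B (range h).
Proof.
have Tc : fun_closed A setT by [].
exact: (@image_closed L T U A B h (Substructure Tc)).
Qed.

Definition range_sub (L : signature) (T U : Type) (A : structure L T)
    (B : structure L U) (h : embedding A B) : substructure B :=
  Substructure (@range_closed L T U A B h).

(** The copies of A in B are the ranges of the embeddings of A in B. *)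
Lemma copiesP (L : signature) (T U : Type) (A : structure L T)
    (B : structure L U) (S : substructure B) :
  copies A B S <-> exists a : embedding A B, range a = universe S.
Proof.
split=> [[h [k _ hK]]|[a aS]].
  exists (emb_comp (emb_val S) h); apply: eq_trans (range_emb_val S).
  apply/seteqP; split=> [_ [x _ <-]|_ [y _ <-]]; first by exists (h x).
  by exists (k y) => //=; rewrite hK.
have [|h hE] := @emb_factor _ _ _ _ A (induced S) B a (emb_val S).
  by rewrite range_emb_val aS.
exists h.
have /choice[k kE] : forall y : universe S, exists x, h x = y.
  move=> y; have : range a (val y) by rewrite aS; exact: set_valP.
  by move=> [x _ ax]; exists x; apply: val_inj; rewrite -ax -hE.
by exists k => // x; apply: (@emb_inj _ _ _ _ _ h); exact: kE.
Qed.

Lemma copies_range (L : signature) (T U : Type) (A : structure L T)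
    (B : structure L U) (h : embedding A B) : copies A B (range_sub h).
Proof. by apply/copiesP; exists h. Qed.

Lemma preimage_closed (L : signature) (T U : Type) (A : structure L T)
  (B : structure L U) (h : embedding A B) (S : substructure B) :
  fun_closed A (h @^-1` universe S).
Proof.
by move=> f x Sx; rewrite /preimage /= emb_fun; exact: universe_closed.
Qed.

Definition preimage_sub (L : signature) (T U : Type) (A : structure L T)
    (B : structure L U) (h : embedding A B) (S : substructure B) :
    substructure A :=
  Substructure (@preimage_closed L T U A B h S).

Lemma image_preimage_sub (L : signature) (T U : Type) (A : structure L T)
    (B : structure L U) (h : embedding A B) (S : substructure B) :
  universe S `<=` range h -> Defs.image_sub h (preimage_sub h S) = S.
Proof.
move=> Sh; apply: substructure_ext; apply/seteqP; split=> [_ [x Sx <-] //|y Sy].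
by have [x _ xy] := Sh y Sy; exists x => //=; rewrite /preimage /= xy.
Qed.

Lemma copies_image (L : signature) (T U V : Type) (A : structure L T)
    (B : structure L U) (C : structure L V) (h : embedding B C)
    (S : substructure B) : copies A B S -> copies A C (Defs.image_sub h S).
Proof.
move=> /copiesP[a aS]; apply/copiesP; exists (emb_comp h a) => /=.
by rewrite -aS image_comp.
Qed.

Lemma copies_preimage (L : signature) (T U V : Type) (A : structure L T)
    (B : structure L U) (C : structure L V) (h : embedding B C)
    (S : substructure C) : universe S `<=` range h ->
  copies A C S -> copies A B (preimage_sub h S).
Proof.
move=> Sh /copiesP[a aS].
have [|f fE] := @emb_factor _ _ _ _ A B C a h; first by rewrite aS.
apply/copiesP; exists f; apply/seteqP; split=> [_ [x _ <-]|y /= Sy].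
  by rewrite /= /preimage /= fE -aS; exists x.
rewrite /preimage /= -aS in Sy; have [x _ ax] := Sy.
by exists x => //; apply: (@emb_inj _ _ _ _ _ h); rewrite fE.
Qed.

(** Embeddings of a rigid structure are determined by their range. *)
Lemma rigid_emb_eq (L : signature) (T U : Type) (A : structure L T)
    (B : structure L U) (a a' : embedding A B) :
  rigid A -> range a = range a' -> a =1 a'.
Proof.
move=> rA aa'.
have [|f fE] := @emb_factor _ _ _ _ A A B a a'; first by rewrite aa'.
have [|g gE] := @emb_factor _ _ _ _ A A B a' a; first by rewrite aa'.
have fb : bijective f.
  exists g => x.
    by apply: (@emb_inj _ _ _ _ _ a); rewrite gE fE.
  by apply: (@emb_inj _ _ _ _ _ a'); rewrite fE gE.
by move=> x; rewrite -fE (rA f fb).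
Qed.

(** * Expansions *)

Definition emb_reduct (L : signature) (I : Type) (ar : I -> nat) (T U : Type)
  (As : structure (add_relations L ar) T)
  (Bs : structure (add_relations L ar) U) (h : embedding As Bs) :
  embedding (reduct As) (reduct Bs).
Proof.
exists h; first exact: emb_inj.
- by move=> f x; exact: (emb_fun h).
- by move=> r x; exact: (@emb_rel _ _ _ _ _ h (inl r)).
Defined.

(** The expansion of A that makes an embedding of A in the reduct of Bs an
    embedding in Bs. *)
Definition pullback (L : signature) (I : Type) (ar : I -> nat) (T U : Type)
    (A : structure L T) (Bs : structure (add_relations L ar) U)
    (h : embedding A (reduct Bs)) : structure (add_relations L ar) T :=
  @Structure (add_relations L ar) T (@fun_interp L T A)
    (fun r => match r return set ('I_(@rarity (add_relations L ar) r) -> T) with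
              | inl r0 => @rel_interp L T A r0
              | inr i =>
                  fun x => @rel_interp (add_relations L ar) U Bs (inr i) (h \o x)
              end).

Lemma reduct_pullback (L : signature) (I : Type) (ar : I -> nat) (T U : Type)
    (A : structure L T) (Bs : structure (add_relations L ar) U)
    (h : embedding A (reduct Bs)) : reduct (pullback h) = A.
Proof. by case: A h. Qed.

Definition emb_pullback (L : signature) (I : Type) (ar : I -> nat)
  (T U : Type) (A : structure L T) (Bs : structure (add_relations L ar) U)
  (h : embedding A (reduct Bs)) : embedding (pullback h) Bs.
Proof.
exists h; first exact: emb_inj.
- by move=> f x; exact: (emb_fun h).
- by case=> [r|i] x //; exact: (emb_rel h).
Defined.

Lemma copies_reduct (L : signature) (I : Type) (ar : I -> nat) (T U : Type)
    (As : structure (add_relations L ar) T)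
    (Bs : structure (add_relations L ar) U) (S : substructure (reduct Bs)) :
  copies As Bs (expand_sub S) -> copies (reduct As) (reduct Bs) S.
Proof.
by move=> /copiesP[a aS]; apply/copiesP; exists (emb_reduct a).
Qed.

(** A copy of A in the reduct of Bs is, within Bs, a copy of some expansion of
    A. *)
Lemma copies_pullback (L : signature) (I : Type) (ar : I -> nat) (T U : Type)
    (A : structure L T) (Bs : structure (add_relations L ar) U)
    (S : substructure (reduct Bs)) :
  copies A (reduct Bs) S ->
  exists As : structure (add_relations L ar) T,
    [/\ reduct As = A, embeds As Bs & copies As Bs (expand_sub S)].
Proof.
move=> /copiesP[a aS]; exists (pullback a); split.
- exact: reduct_pullback.
- exact: inhabits (emb_pullback a).
- by apply/copiesP; exists (emb_pullback a).
Qed.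

(** If As embeds in all expansions of B in Ks, it embeds in all elements of Ks
    whose reduct contains B. *)
Lemma embeds_expansion_up (L : signature) (I : Type) (ar : I -> nat)
    (Ks : structure_class (add_relations L ar)) (T U V : Type)
    (As : structure (add_relations L ar) T) (B : structure L U)
    (Cs : structure (add_relations L ar) V) :
  hereditary Ks ->
  (forall Bs : structure (add_relations L ar) U,
     Ks U Bs -> reduct Bs = B -> embeds As Bs) ->
  Ks V Cs -> embeds B (reduct Cs) -> embeds As Cs.
Proof.
move=> Kh AB KC [h].
have hC : embeds (pullback h) Cs by exact: inhabits (emb_pullback h).
exact: embeds_trans (AB _ (Kh _ _ _ _ KC hC) (reduct_pullback h)) hC.
Qed.

(** * A subclass with the expansion property *)

(** The elements of Ks in which no M n with n in S embeds. *)
Definition avoiding (L : signature) (Ks : structure_class L) (V : nat -> Type)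
    (M : forall n, structure L (V n)) (S : set nat) : structure_class L :=
  fun T As => Ks T As /\ forall n, S n -> ~ embeds (M n) As.

Lemma avoiding_hereditary (L : signature) (Ks : structure_class L)
    (V : nat -> Type) (M : forall n, structure L (V n)) (S : set nat) :
  hereditary Ks -> hereditary (avoiding Ks M S).
Proof.
move=> Kh T U As Bs [KB BS] AB; split; first exact: Kh KB AB.
by move=> n Sn MA; exact: BS n Sn (embeds_trans MA AB).
Qed.

(** A maximal set of structures M n that can be omitted while every element of
    K keeps an expansion; finiteness of the sets of expansions is what makes
    Zorn's lemma applicable. *)
Lemma exists_maximal_avoided (L : signature) (I : Type) (ar : I -> nat)
    (K : structure_class L) (Ks : structure_class (add_relations L ar))
    (V : nat -> Type) (M : forall n, structure (add_relations L ar) (V n)) :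
  expansion_class K Ks ->
  (forall (T : Type) (A : structure L T), K T A -> finite_set
     [set As : structure (add_relations L ar) T | Ks T As /\ reduct As = A]) ->
  exists S : set nat, expansion_class K (avoiding Ks M S) /\
    forall n, expansion_class K (avoiding Ks M (n |` S)) -> S n.
Proof.
move=> [KsK KKs] fin.
have [|S [SK Smax]] := @Zorn_bigcup nat
    [set S | expansion_class K (avoiding Ks M S)].
  move=> Fam FamK Famtot; split=> [T As [/KsK] //|T A KA].
  apply: contrapT => noexp.
  (* Each expansion of A in Ks contains some M n with n in a member of the
     chain. *)
  have bad As : Ks T As -> reduct As = A ->
      exists X, Fam X /\ exists n, X n /\ embeds (M n) As.
    move=> KsA AsA; apply: contrapT => good; apply: noexp; exists As.
    split=> //; split=> // n [X FX Xn] MA.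
    by apply: good; exists X; split => //; exists n.
  have [As0 [KsA0 A0]] := KKs T A KA.
  have [X0 [FX0 _]] := bad _ KsA0 A0.
  (* Finitely many members of the chain are involved, so one is enough. *)
  have chain (E : set (structure (add_relations L ar) T)) : finite_set E ->
      (forall As, E As -> Ks T As /\ reduct As = A) ->
      exists X, Fam X /\ forall As, E As -> exists n, X n /\ embeds (M n) As.
    elim/finite_set_induction: E / => [_|As E IH xE]; first by exists X0.
    have [|X [FX XE]] := IH; first by move=> y Ey; apply: xE; right.
    have [KsA AsA] := xE As (or_introl erefl).
    have [Y [FY [n [Yn MA]]]] := bad As KsA AsA.
    have [XY|YX] := Famtot X Y FX FY.
    - exists Y; split=> // As' [->|/XE[m [Xm MA']]]; first by exists n.
      by exists m; split=> //; exact: XY.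
    - exists X; split=> // As' [->|/XE //].
      by exists n; split=> //; exact: YX.
  have [//|X [FX XA]] := chain _ (fin T A KA).
  have [_ /(_ T A KA)[As [[KsA avA] AsA]]] := FamK X FX.
  have [n [Xn MA]] := XA As (conj KsA AsA).
  exact: avA n Xn MA.
exists S; split=> // n SnK; apply: contrapT => nS.
apply: (Smax (n |` S)) => //; split; first by right.
by move=> /(_ n (or_introl erefl)).
Qed.

(** By maximality of the omitted family, each As in the subclass embeds in all
    the expansions, in the subclass, of some element of K; for the finitely many
    expansions of a given structure these elements are joined by joint
    embedding. *)
Lemma exists_expansion_property (L : signature) (I : Type) (ar : I -> nat)
    (K : structure_class L) (Ks : structure_class (add_relations L ar)) :
  countable_up_to_iso Ks -> hereditary Ks -> joint_embedding K ->
  expansion_class K Ks ->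
  (forall (T : Type) (A : structure L T), K T A -> finite_set
     [set As : structure (add_relations L ar) T | Ks T As /\ reduct As = A]) ->
  exists Ks' : structure_class (add_relations L ar),
    [/\ forall (T : Type) (As : structure (add_relations L ar) T),
          Ks' T As -> Ks T As,
        hereditary Ks' & expansion_property K Ks'].
Proof.
move=> [V [M Menum]] Ksh Kjep KKs fin.
have [S [KS Smax]] := exists_maximal_avoided M KKs fin.
have Kh : hereditary (avoiding Ks M S) by exact: avoiding_hereditary.
exists (avoiding Ks M S); split=> // [T As []//|].
split=> // T A KA.
have force (As : structure (add_relations L ar) T) : avoiding Ks M S As ->
    exists (U : Type) (B : structure L U), K U B /\
      forall Bs, avoiding Ks M S Bs -> reduct Bs = B -> embeds As Bs.
  move=> [KsA avA]; have [n An] := Menum _ _ KsA.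
  have nS : ~ S n.
    by move=> /avA; apply; exact/isomorphic_embeds/isomorphic_sym.
  apply: contrapT => noB; apply: nS; apply: Smax.
  split=> [U Bs [/KKs.1] //|U B KB]; apply: contrapT => noexp.
  apply: noB; exists U, B; split=> // Bs [KsB avB] BsB.
  apply: contrapT => AB; apply: noexp; exists Bs; split=> //; split=> // m.
  move=> [->|/avB //] MB.
  by apply: AB; exact: embeds_trans (isomorphic_embeds An) MB.
suff [U [B [KB BE]]] : exists (U : Type) (B : structure L U), K U B /\
    forall As, [set As | Ks T As /\ reduct As = A] As -> avoiding Ks M S As ->
    forall Bs, avoiding Ks M S Bs -> reduct Bs = B -> embeds As Bs.
  by exists U, B; split=> // As Bs KsA KsB AsA; apply: BE => //; case: KsA.
move: [set As | _] (fin T A KA).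
apply: finite_set_induction => [|As E [U [B [KB BE]]]]; first by exists T, A.
have [/force[U' [B' [KB' B'A]]]|nKsA] := pselect (avoiding Ks M S As); last first.
  by exists U, B; split=> // As' [->|/BE].
have [W [C [KC BC B'C]]] := Kjep _ _ _ _ KB KB'.
exists W, C; split=> // As' [-> _|/BE{}BE KsA'] Cs KsC CsC; rewrite -CsC in BC B'C.
- exact: embeds_expansion_up Kh B'A KsC B'C.
- exact: embeds_expansion_up Kh (BE KsA') KsC BC.
Qed.

(** Join in K elements whose expansions contain the two given structures, and
    expand the result. *)
Lemma joint_embedding_expansion (L : signature) (I : Type) (ar : I -> nat)
    (K : structure_class L) (Ks : structure_class (add_relations L ar)) :
  hereditary Ks -> joint_embedding K -> expansion_property K Ks ->
  joint_embedding Ks.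
Proof.
move=> Kh Kjep [[KsK KKs] Kep] T U As Bs KsA KsB.
have [T' [A' [KA' A'A]]] := Kep _ _ (KsK _ _ KsA).
have [U' [B' [KB' B'B]]] := Kep _ _ (KsK _ _ KsB).
have [V [C [KC AC BC]]] := Kjep _ _ _ _ KA' KB'.
have [Cs [KsC CsC]] := KKs _ _ KC; rewrite -CsC in AC BC.
exists V, Cs; split=> //.
- by apply: embeds_expansion_up Kh _ KsC AC => Ds KsD; exact: A'A.
- by apply: embeds_expansion_up Kh _ KsC BC => Ds KsD; exact: B'B.
Qed.

(** * The Ramsey property and amalgamation *)

(** Here the type of a copy of A in an expansion is the isomorphism class of the
    expansion of A that it carries; rep lists the types that occur in Ks. *)
Lemma ramsey_expansion (L : signature) (I : Type) (ar : I -> nat)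
    (K : structure_class L) (Ks0 Ks : structure_class (add_relations L ar)) :
  (forall (T : Type) (As : structure (add_relations L ar) T),
     Ks T As -> Ks0 T As) ->
  hereditary Ks -> joint_embedding K ->
  (forall (T : Type) (A : structure L T), K T A -> finite_set
     [set As : structure (add_relations L ar) T | Ks T As /\ reduct As = A]) ->
  relative_ramsey K Ks0 -> expansion_property K Ks -> ramsey_property Ks.
Proof.
move=> KsKs0 Kh Kjep fin Kram [[KsK KKs] Kep] k T U As Bs KsA KsB.
pose A := reduct As; have KA : K T A by exact: KsK.
have [n [rep [repE repI repR]]] := finite_transversal
  (R := @isomorphic (add_relations L ar) T T)
  (fun x => isomorphic_refl x) (fun x y => @isomorphic_sym _ _ _ x y) (fin _ _ KA).
have [T' [A' [KA' A'A]]] := Kep _ _ KA.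
have [U' [B' [KB' B'B]]] := Kep _ _ (KsK _ _ KsB).
have [W [D [KD AD BD]]] := Kjep _ _ _ _ KA' KB'.
have [Ds [KsD DsD]] := KKs _ _ KD; subst D.
have [V [C [KC Cram]]] := Kram (k + n) _ _ A Ds KA (KsKs0 _ _ KsD).
have [Cs [KsC CsC]] := KKs _ _ KC; subst C.
(* All expansions of D in Ks contain Bs and all types. *)
have realise (X : structure (add_relations L ar) W) : Ks W X ->
    reduct X = reduct Ds -> (forall i, embeds (rep i) X) /\ embeds Bs X.
  move=> KsX XD; rewrite -XD in AD BD; split=> [i|].
    have [KsR RA] := repE i.
    by apply: embeds_expansion_up Kh _ KsX AD => Y KsY; exact: A'A.
  by apply: embeds_expansion_up Kh _ KsX BD => Y KsY; exact: B'B.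
have typeP (X : Type) (Xs : structure (add_relations L ar) X)
    (S : substructure (reduct Xs)) : Ks X Xs -> copies A (reduct Xs) S ->
    exists i, copies (rep i) Xs (expand_sub S).
  move=> KsX /copies_pullback[A1 [A1A A1X A1S]].
  have [i A1i] := repR A1 (conj (Kh _ _ _ _ KsX A1X) A1A).
  by exists i; exact: isomorphic_trans (isomorphic_sym A1i) A1S.
have type_uniq (X : Type) (Xs : structure (add_relations L ar) X)
    (S : substructure Xs) i j : copies (rep i) Xs S -> copies (rep j) Xs S -> i = j.
  by move=> iS jS; apply: repI; exact: isomorphic_trans iS (isomorphic_sym jS).
have rep_reduct i : reduct (rep i) = A by have [] := repE i.
exists V, Cs; split=> // c ck.
have /choice[ty tyP] : forall S : substructure (reduct Cs), exists m : nat,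
    copies A (reduct Cs) S ->
    exists2 i : 'I_n, m = i & copies (rep i) Cs (expand_sub S).
  move=> S; have [/(typeP _ _ _ KsC)[i iS]|nS] := pselect (copies A (reduct Cs) S).
    by exists i => _; exists i.
  by exists 0.
(* The colours from k on encode the types other than that of As. *)
pose c' S := if `[< copies As Cs (expand_sub S) >] then c (expand_sub S)
             else k + ty S.
have [|b bram] := Cram c'.
  move=> S AS; rewrite /c' /=; case: asboolP => [/ck/= cS|_].
    exact: leq_trans cS (leq_addr _ _).
  by have [i -> _] := tyP S AS; rewrite ltn_add2l.
(* Equal colours force equal types in Cs. *)
have c'_type S0 S1 i : copies A (reduct Cs) S0 -> copies A (reduct Cs) S1 ->
    c' S0 = c' S1 -> copies (rep i) Cs (expand_sub S0) ->
    copies (rep i) Cs (expand_sub S1).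
  move=> AS0 AS1; rewrite /c'; case: asboolP => [S0A|_]; case: asboolP => [S1A|_].
  - move=> _ iS0; apply: isomorphic_trans iS0 _.
    exact: isomorphic_trans (isomorphic_sym S0A) S1A.
  - by move=> cE; have := ck _ S0A; rewrite cE /= ltnNge leq_addr.
  - by move=> cE; have := ck _ S1A; rewrite -cE /= ltnNge leq_addr.
  - move=> /addnI; have [j -> jS0] := tyP _ AS0; have [l -> lS1] := tyP _ AS1.
    by move=> /val_inj jl iS0; rewrite (type_uniq _ _ _ _ _ iS0 jS0) jl.
pose D1 := pullback b; pose b1 : embedding D1 Cs := emb_pullback b.
have KsD1 : Ks W D1 by apply: Kh KsC (inhabits b1).
have [D1rep [d1]] := realise _ KsD1 (reduct_pullback b).
have [Drep _] := realise _ KsD erefl.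
(* A copy in Cs of an expansion of A that lies in the range of b comes from a
   copy of A in D. *)
have back (X : structure (add_relations L ar) T) (Q : substructure Cs) :
    reduct X = A -> copies X Cs Q -> universe Q `<=` range b ->
    exists S : substructure (reduct Ds), [/\ copies A (reduct Ds) S,
      copies A (reduct Cs) (Defs.image_sub b S) & expand_sub (Defs.image_sub b S) = Q].
  move=> XA XQ Qb.
  pose Q' : substructure (reduct Cs) :=
    @Substructure L V (reduct Cs) (universe Q) (@universe_closed _ _ _ Q).
  have Q'Q : expand_sub Q' = Q by exact: substructure_ext.
  have AQ' : copies A (reduct Cs) Q' by rewrite -XA; apply: copies_reduct; rewrite Q'Q.
  have bQ' : Defs.image_sub b (preimage_sub b Q') = Q' by exact: image_preimage_sub.
  exists (preimage_sub b Q'); rewrite bQ'; split=> //.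
  exact: copies_preimage.
(* As b equalises colours on the types of Ds, the type in Ds of a copy of A in D
   determines the type in Cs of its image; psi is the resulting map of types. *)
have /choice[psi psiP] : forall i : 'I_n, exists j : 'I_n,
    forall S : substructure (reduct Ds), copies (rep i) Ds (expand_sub S) ->
    copies (rep j) Cs (expand_sub (Defs.image_sub b S)).
  move=> i; have [a] := Drep i.
  pose Si : substructure (reduct Ds) :=
    @Substructure L W (reduct Ds) (range a) (@range_closed _ _ _ _ _ a).
  have iSi : copies (rep i) Ds (expand_sub Si) by apply/copiesP; exists a.
  have AD' S : copies (rep i) Ds (expand_sub S) -> copies A (reduct Ds) S.
    by move=> /copies_reduct; rewrite rep_reduct.
  have [j jSi] := typeP _ _ _ KsC (copies_image b (AD' _ iSi)).
  exists j => S iS; apply: c'_type jSi.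
  - exact/copies_image/AD'.
  - exact/copies_image/AD'.
  - apply: bram; [exact: AD'|exact: AD'|].
    exact: isomorphic_trans (isomorphic_sym iSi) iS.
(* Types being finite in number, it is enough that psi is onto: the expansion of D
   induced by Cs along b lies in Ks, so it realises all types. *)
have psi_inj : injective psi.
  apply: surj_ord_inj => j; have [a] := D1rep j.
  have [|||S [AS bAS SQ]] := back (rep j) (range_sub (emb_comp b1 a)).
  - exact: rep_reduct.
  - exact: copies_range.
  - by move=> _ [x _ <-]; exists (a x).
  have [i iS] := typeP _ _ _ KsD AS; exists i.
  apply: (type_uniq _ _ _ _ _ (psiP i S iS)); rewrite SQ; exact: copies_range.
have [jA AjA] := repR As (conj KsA erefl).
exists (range_sub (emb_comp b1 d1)); first exact: copies_range.
have B0b : range (emb_comp b1 d1) `<=` range b by move=> _ [x _ <-]; exists (d1 x).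
move=> A0 A1 AA0 AA1 A0B A1B.
have [S0 [AS0 bS0 S0A]] := back As A0 erefl AA0 (subset_trans A0B B0b).
have [S1 [AS1 bS1 S1A]] := back As A1 erefl AA1 (subset_trans A1B B0b).
have psiA i S Q : copies (rep i) Ds (expand_sub S) ->
    expand_sub (Defs.image_sub b S) = Q -> copies As Cs Q -> psi i = jA.
  move=> iS <- AQ; apply: type_uniq (psiP i S iS) _.
  exact: isomorphic_trans (isomorphic_sym AjA) AQ.
have [i0 i0S] := typeP _ _ _ KsD AS0.
have [i1 i1S] := typeP _ _ _ KsD AS1.
have i01 : i0 = i1.
  by apply: psi_inj; rewrite (psiA _ _ _ i0S S0A AA0) (psiA _ _ _ i1S S1A AA1).
rewrite -i01 in i1S.
have := bram S0 S1 AS0 AS1 (isomorphic_trans (isomorphic_sym i0S) i1S).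
by rewrite /c' S0A S1A !asboolT.
Qed.

(** Colour a copy of A in a Ramsey witness E by whether the embedding of A onto
    it, which is unique by rigidity, extends along f. *)
Lemma amalgamation_ramsey (L : signature) (Ks : structure_class L) :
  (forall (T : Type) (A : structure L T), Ks T A -> rigid A) ->
  joint_embedding Ks -> ramsey_property Ks -> amalgamation Ks.
Proof.
move=> Krig Kjep Kram T U V A B C KA KB KC f g.
have [W [D [KD [j1] [j2]]]] := Kjep _ _ _ _ KB KC.
have [X [E [KE Eram]]] := Kram 2 _ _ A D KA KD.
pose extends (Q : substructure E) := exists a : embedding A E,
  range a = universe Q /\ exists r : embedding B E, forall x, r (f x) = a x.
have [|D0 /copiesP[d dD0] D0mono] := Eram (fun Q => nat_of_bool `[< extends Q >]).
  by move=> Q _ /=; case: `[< _ >].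
pose a0 := emb_comp d (emb_comp j1 f); pose a1 := emb_comp d (emb_comp j2 g).
have sub0 : range a0 `<=` universe D0.
  by rewrite -dD0 => _ [x _ <-]; exists (j1 (f x)).
have sub1 : range a1 `<=` universe D0.
  by rewrite -dD0 => _ [x _ <-]; exists (j2 (g x)).
have := D0mono (range_sub a0) (range_sub a1) (copies_range a0) (copies_range a1)
  sub0 sub1.
rewrite asboolT; last by exists a0; split=> //; exists (emb_comp d j1).
case: asboolP => // -[a [aa1 [r rf]]] _.
exists X, E; split=> //; exists r, (emb_comp d j2) => x.
by rewrite rf (rigid_emb_eq (Krig _ _ KA) aa1).
Qed.

(** * Ages *)

(** The substructure generated by X. *)
Definition generated (L : signature) (T : Type) (A : structure L T)
  (X : set T) : substructure A.
Proof.
exists (smallest (fun_closed A) X) => f x Sx B [Bc XB].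
by apply: (Bc f x) => i; exact: Sx.
Defined.

Lemma finite_emb (L : signature) (T U : Type) (A : structure L T)
    (B : structure L U) (h : embedding A B) :
  finite_set (range h) -> finite_set [set: T].
Proof.
have hT : card_eq (range h) [set: T].
  by apply: inj_card_eq => x y _ _; exact: emb_inj.
by rewrite (eq_finite_set hT).
Qed.

Lemma age_hereditary (L : signature) (V : Type) (F : structure L V) :
  hereditary (age F).
Proof.
move=> T U A B [Ufin BF] AB; split; last exact: embeds_trans AB BF.
have [h] := AB; apply: (finite_emb (h := h)) => //; exact: sub_finite_set Ufin.
Qed.

Lemma age_finite_generated (L : signature) (V : Type) (F : structure L V)
    (X : set V) : locally_finite F -> finite_set X ->
  age F (induced (generated F X)).
Proof.
move=> Flf /Flf Xfin; split; last exact: inhabits (emb_val _).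
by apply: (finite_emb (h := emb_val (generated F X))); rewrite range_emb_val.
Qed.

Lemma age_joint_embedding (L : signature) (V : Type) (F : structure L V) :
  locally_finite F -> joint_embedding (age F).
Proof.
move=> Flf T U A B [Tfin [f]] [Ufin [g]].
have sub : range f `|` range g `<=` universe (generated F (range f `|` range g)).
  exact: sub_gen_smallest.
exists _, (induced (generated F (range f `|` range g))); split.
- by apply: age_finite_generated => //; rewrite finite_setU; split; exact: finite_image.
- have [|h _] := emb_factor (f := f) (g := emb_val (generated F (range f `|` range g))).
    by rewrite range_emb_val => x fx; apply: sub; left.
  exact: inhabits h.
- have [|h _] := emb_factor (f := g) (g := emb_val (generated F (range f `|` range g))).
    by rewrite range_emb_val => x gx; apply: sub; right.
  exact: inhabits h.
Qed.

Lemma age_countable (L : signature) (F : structure L nat) :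
  countable_up_to_iso (age F).
Proof.
pose S n := generated F [set` odflt [::] (unpickle n : option (seq nat))].
exists (fun n => universe (S n)), (fun n => induced (S n)).
move=> T A [Tfin [h]].
have /finite_seqP[s hs] : finite_set (range h) by exact: finite_image.
exists (pickle (s : seq nat)); apply/copiesP; exists h.
have -> : S (pickle (s : seq nat)) = generated F [set` s].
  by rewrite /S pickleK.
rewrite /= -hs smallest_id //; exact: range_closed.
Qed.

Lemma age_arbitrarily_large (L : signature) (F : structure L nat) (n : nat) :
  locally_finite F ->
  exists (T : Type) (A : structure L T), age F A /\ card_le `I_n [set: T].
Proof.
move=> Flf; exists _, (induced (generated F `I_n)); split.
  by apply: age_finite_generated => //; exact: finite_II.
apply: (@card_le_trans _ _ _ (universe (generated F `I_n))).
  by apply: subset_card_le; exact: sub_gen_smallest.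
have := card_image_le (emb_val (generated F `I_n)) setT.
by rewrite range_emb_val.
Qed.

Lemma age_expansion (L : signature) (I : Type) (ar : I -> nat) (V : Type)
    (Fs : structure (add_relations L ar) V) :
  expansion_class (age (reduct Fs)) (age Fs).
Proof.
split=> [T As [Tfin [h]]|T A [Tfin [h]]].
  by split=> //; exact: inhabits (emb_reduct h).
exists (pullback h); split; last exact: reduct_pullback.
by split=> //; exact: inhabits (emb_pullback h).
Qed.

Theorem theorem4 (L : signature) (I : Type) (ar : I -> nat)
    (L_countable : countable_signature L) (I_countable : countable [set: I])
    (F : structure L nat) (Fs : structure (add_relations L ar) nat)
    (F_fraisse : fraisse_structure F)
    (Fs_fraisse : fraisse_structure Fs)
    (Fs_expansion : reduct Fs = F)
    (Fs_precompact : precompact F Fs)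
    (Fs_rigid : forall (T : Type) (As : structure (add_relations L ar) T),
       age Fs As -> rigid As)
    (Fs_ramsey : relative_ramsey (age F) (age Fs)) :
  exists Ks : structure_class (add_relations L ar),
    [/\ forall (T : Type) (As : structure (add_relations L ar) T),
          Ks T As -> age Fs As,
        fraisse_class Ks,
        ramsey_property Ks
      & expansion_property (age F) Ks].
Proof.
have [_ _ Flf _] := F_fraisse.
have Fjep := age_joint_embedding Flf.
have Fexp : expansion_class (age F) (age Fs).
  by rewrite -Fs_expansion; exact: age_expansion.
have [Ks [KsFs Kh Kep]] := exists_expansion_property (age_countable Fs)
  (@age_hereditary _ _ Fs) Fjep Fexp Fs_precompact.
have fin (T : Type) (A : structure L T) : age F A -> finite_set
    [set As : structure (add_relations L ar) T | Ks T As /\ reduct As = A].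
  move=> FA; apply: sub_finite_set (Fs_precompact _ _ FA).
  by move=> As [/KsFs].
have Kram := ramsey_expansion KsFs Kh Fjep fin Fs_ramsey Kep.
have Kjep := joint_embedding_expansion Kh Fjep Kep.
exists Ks; split=> //; split; last split=> //.
- by move=> T A /KsFs[].
- have [V [M Menum]] := age_countable Fs.
  by exists V, M => T A /KsFs/Menum.
- move=> n; have [T [A [FA nT]]] := age_arbitrarily_large n Flf.
  have [[_ /(_ T A FA)[As [KsA _]]] _] := Kep.
  by exists T, As.
- by apply: amalgamation_ramsey Kjep Kram => T A /KsFs; exact: Fs_rigid.
Qed.
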